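(* Suppose that the distribution function of $\varphi$ is continuous and strictly increasing on $(0,\infty)$. Then: (a) For every $\lambda\in(0,1)$ and $v\in(0,K)$, the Neyman–Pearson problem for $\rho_\lambda$ with capital constraint $v$ has a unique solution $X^*$, which is $P$-a.s. of the form $$X^*=\beta+\bigl(I(c(\varphi\vee y))-I(cy)\bigr)\wedge(K-\beta),$$ where $\beta$, $y$ and $c$ are constants such that $\beta\ge0$, $y\ge q$ and $c=\ell'(\beta)/y$. (b) For every $\lambda\in(0,1)$, there exists a critical value $v_\lambda\in(0,K\,E[\varphi;\varphi\ge q])$ such that $\beta=0$ if $v\le v_\lambda$, and $0<\beta<v$ for $v>v_\lambda$. (c) The parameters $\beta$, $c$ and $y$ are increasing functions of $v$.
   Context: $(\Omega,\mathcal F,P)$ is an atomless probability space, $K>0$ is a constant, and the price density $\varphi$ is a random variable, unbounded from above, with $\varphi>0$ $P$-a.s. and $E[\varphi]=1$. Notation: $E[X;\varphi\in A]:=E[X\mathbb I_{\{\varphi\in A\}}]$, $x\vee y=\max\{x,y\}$, $x\wedge y=\min\{x,y\}$; ''increasing'' means nondecreasing. Uniqueness of solutions is understood up to $P$-a.s. equality. The loss function $\ell$ is a real function on an open interval containing $[0,K]$ that is strictly increasing, strictly convex and continuously differentiable (it arises from a utility function $u$ via $\ell(x)=-u(-x)$). Its derivative $\ell'$ is a bijection from the domain of $\ell$ onto some interval $(a,b)\subset(0,\infty)$. Its inverse is extended to $\mathbb R$ by $I(x)=+\infty$ for $x\ge b$, $I(x)=(\ell')^{-1}(x)$ for $a<x<b$,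 and $I(x)=-\infty$ for $x\le a$. For $\lambda\in(0,1]$, $\mathcal Q_\lambda$ is the set of probability measures $Q\ll P$ with $dQ/dP\le1/\lambda$ $P$-a.s., and $\rho_\lambda(-X):=\max_{Q\in\mathcal Q_\lambda}E_Q[\ell(X)]$ for $0\le X\le K$. Let $q:=q_\varphi(1-\lambda)$ be the $(1-\lambda)$-quantile of $\varphi$ under $P$. The Neyman–Pearson problem for $\rho_\lambda$ with capital constraint $v$ is: minimize $\rho_\lambda(-X)$ over all random variables $X$ with $0\le X\le K$ and $E[\varphi X]\ge v$.
   Formalization: In (c) the formal theorem states that β and c are increasing but y is decreasing (nonincreasing) in v; the claim that y increases is false, since for v ≤ v_λ one has β=0 and cy=ℓ'(0), so c and y cannot both increase. *)

(* Defs.v *)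
From HB Require Import structures.
From mathcomp Require Import all_boot all_order all_algebra.
From mathcomp Require Import all_classical all_reals all_analysis.

Set Implicit Arguments.
Unset Strict Implicit.
Unset Printing Implicit Defensive.

Import Order.TTheory GRing.Theory Num.Theory.
Import numFieldNormedType.Exports.

Local Open Scope classical_set_scope.
Local Open Scope ring_scope.

Section probability_space.
Context (R : realType) (d : measure_display) (T : measurableType d).
Variable P : probability T R.

Definition atomless := forall A : set T, measurable A -> (0 < P A)%E ->
  exists B, [/\ measurable B, B `<=` A, (0 < P B)%E & (P B < P A)%E].

Definition expectation_on (X : T -> R) (A : set T) : \bar R :=
  'E_P[(fun w => X w * \1_A w)%R]%E.

(* The lower quantile; when the distribution function is continuous and
   strictly increasing on (0, +oo) and X > 0 a.s., it is the only t-quantile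
   for 0 < t < 1. *)
Definition quantile (X : {RV P >-> R}) (t : R) : R :=
  inf [set x | (t%:E <= cdf X x)%E].

Definition Q_ (lambda : R) :=
  [set Q : probability T R | Q `<< P /\
    {ae P, forall w,
      (Radon_Nikodym (charge_of_finite_measure Q) P w <= lambda^-1%:E)%E}].

(* [rho lambda ell X] is rho_lambda(-X). *)
Definition rho (lambda : R) (ell : R -> R) (X : {RV P >-> R}) : \bar R :=
  ereal_sup [set 'E_Q[ell \o X]%E | Q in Q_ lambda].

End probability_space.

Section loss.
Context (R : realType).

Definition strictly_convex_on (D : set R) (f : R -> R) :=
  forall x y t, D x -> D y -> x != y -> 0 < t < 1 ->
    f (t * x + (1 - t) * y) < t * f x + (1 - t) * f y.

(* The finite number a is allowed to be 0, and b to be +oo. *)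
Record loss_function (K : R) (D : set R) (a : R) (b : \bar R) (ell : R -> R)
    : Prop := LossFunction {
  loss_open : open D ;
  loss_interval : is_interval D ;
  loss_sub : `[0, K] `<=` D ;
  loss_incr : {in D &, {homo ell : x y / x < y}} ;
  loss_convex : strictly_convex_on D ell ;
  loss_derivable : {in D, forall x, derivable ell x 1} ;
  loss_C1 : {in D, continuous (derive1 ell)} ;
  loss_range_ge0 : 0 <= a ;
  loss_bij : set_bij D [set x : R | a < x /\ (x%:E < b)%E] (derive1 ell) }.

Definition ext_inv (D : set R) (a : R) (b : \bar R) (ell : R -> R) (x : R)
    : \bar R :=
  if (b <= x%:E)%E then +oo%E
  else if x <= a then -oo%E
  else ('pinv_(fun=> 0) D (derive1 ell) x)%:E.

End loss.

Section Neyman_Pearson.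
Context (R : realType) (d : measure_display) (T : measurableType d).
Variables (P : probability T R) (phi : {RV P >-> R}) (K : R) (ell : R -> R).

Definition admissible (v : R) (X : {RV P >-> R}) :=
  (forall w, 0 <= X w <= K) /\ (v%:E <= 'E_P[(fun w => phi w * X w)%R])%E.

Definition NP_solution (lambda v : R) (X : {RV P >-> R}) :=
  admissible v X /\
  forall Y : {RV P >-> R}, admissible v Y -> (rho lambda ell X <= rho lambda ell Y)%E.

(* [beta] must lie in [D] for [derive1 ell beta] to be meaningful. *)
Definition NP_form (D : set R) (a : R) (b : \bar R) (lambda : R)
    (X : {RV P >-> R}) (beta y c : R) :=
  let I := ext_inv D a b ell in
  [/\ D beta /\ 0 <= beta,
      quantile phi (1 - lambda) <= y,
      c = derive1 ell beta / y &
      {ae P, forall w, (X w)%:E =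
        (beta%:E + mine (I (c * Num.max (phi w) y)%R - I (c * y)%R)
                        (K - beta)%R%:E)%E}].

End Neyman_Pearson.

(* Main.v *)
Require Import Defs.
From HB Require Import structures.
From mathcomp Require Import all_boot all_order all_algebra.
From mathcomp Require Import all_classical all_reals all_analysis.
From mathcomp Require Import measurable_realfun lra ring.

Set Implicit Arguments.
Unset Strict Implicit.
Unset Printing Implicit Defensive.

Import Order.TTheory GRing.Theory Num.Theory.
Import numFieldNormedType.Exports.

Local Open Scope classical_set_scope.
Local Open Scope ring_scope.

(** The worst-case measure of the problem is known in advance, and it turns
    the robust problem into a pointwise minimisation.

    Let y0 be the level with E[phi /\ y0] = lambda y0; it exists and lies
    above the quantile q, by the intermediate value theorem between q and
    1 / lambda ([exists_truncation_level]).  Then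
    psi = (phi /\ y0) / (lambda y0) is the density of a measure Q0 of
    Q_lambda.  Let h = (I \/ 0) /\ K be the inverse of l' clipped to [0, K],
    and consider for c > 0 the position X_c = h(c (phi \/ y0)).

    - Since phi / psi = lambda (phi \/ y0), the value X_c minimises pointwise
      the Lagrangian x |-> psi l(x) - (c / lambda) phi x over [0, K], strictly
      because l is strictly convex ([clip_inv_Lagrangian]).  Hence X_c is, up
      to null sets, the only minimiser of E_Q0[l(X)] among the positions that
      cost at least E[phi X_c] ([opt_position_optimal]).
    - The density psi takes the largest value 1 / lambda allowed in Q_lambda
      wherever X_c exceeds its minimum h(c y0), so no measure of Q_lambda
      gives l(X_c) a larger expectation than Q0 does ([rho_opt_position]).
      As rho_lambda dominates E_Q0[l(X)] for every X, the position X_c is the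
      unique solution for the constraint v = E[phi X_c].
    - The cost E[phi X_c] is continuous in c and runs from 0 to K, so every v
      in (0, K) is reached ([exists_cost]).

    For the parameters, X_c has the announced form with beta = h(c y0) and
    y = y0 \/ l'(0) / c ([opt_position_form]).  While c <= l'(0) / y0 this
    gives beta = 0 and a decreasing y; beyond, y stays at y0 and beta grows.
    The critical value v_lambda is therefore the cost at c = l'(0) / y0.  The
    law of phi charges every open subinterval of (0, +oo), which makes the
    comparisons of costs strict and the parameters of the form unique
    ([form_parameters_unique]). *)

(** * Almost sure comparison of real integrals *)

Section ae_integral.
Context (R : realType) (d : measure_display) (T : measurableType d).
Variable P : probability T R.
Implicit Types f g : T -> R.

Lemma integrable_dominated f g : measurable_fun setT f ->
  P.-integrable setT (EFin \o g) -> (forall w, `|f w| <= g w) ->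
  P.-integrable setT (EFin \o f).
Proof.
move=> mf intg fg; apply: (le_integrable measurableT _ _ intg) => /=.
  exact/measurable_EFinP.
by move=> w _; rewrite lee_fin (le_trans (fg w))// ler_norm.
Qed.

Lemma integrable_bounded f M : measurable_fun setT f ->
  (forall w, `|f w| <= M) -> P.-integrable setT (EFin \o f).
Proof.
move=> mf fM; apply: (integrable_dominated mf _ fM).
exact: finite_measure_integrable_cst.
Qed.

Lemma integrable_bounded_mul f g M : P.-integrable setT (EFin \o f) ->
  measurable_fun setT g -> (forall w, `|g w| <= M) ->
  P.-integrable setT (EFin \o (fun w => f w * g w)).
Proof.
move=> intf mg gM.
apply: (@integrable_dominated _ (fun w => M * `|f w|)).
- apply: measurable_funM => //; apply/measurable_EFinP.
  exact: measurable_int intf.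
- have /= := integrableZl measurableT M (integrable_norm intf).
  by apply: eq_integrable => // w _ /=; rewrite EFinM.
- by move=> w; rewrite normrM mulrC ler_wpM2r.
Qed.

Lemma ae_eq_Rintegral f g : P.-integrable setT (EFin \o f) ->
  P.-integrable setT (EFin \o g) -> {ae P, forall w, f w = g w} ->
  \int[P]_w f w = \int[P]_w g w.
Proof.
move=> intf intg fg; congr fine; apply: ae_eq_integral => //=.
- exact: measurable_int intf.
- exact: measurable_int intg.
- by apply: filterS fg => w -> _.
Qed.

Lemma ae_le_Rintegral f g : P.-integrable setT (EFin \o f) ->
  P.-integrable setT (EFin \o g) -> {ae P, forall w, f w <= g w} ->
  \int[P]_w f w <= \int[P]_w g w.
Proof.
move=> intf intg fg.
have mf : measurable_fun setT f.
  by apply/measurable_EFinP; apply: measurable_int intf.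
have mg : measurable_fun setT g.
  by apply/measurable_EFinP; apply: measurable_int intg.
have mfg : measurable_fun setT (f \min g) by exact: measurable_minr.
have intm : P.-integrable setT (EFin \o (f \min g)).
  apply: (@le_integrable _ _ _ P setT measurableT _
     (fun w => (`|f w| + `|g w|)%:E)).
  - exact/measurable_EFinP.
  - move=> w _; rewrite lee_fin /= [leRHS]ger0_norm ?addr_ge0//.
    rewrite /Num.min; case: ifP => _; by rewrite ?lerDl ?lerDr.
  - have intnf := integrable_norm intf; have intng := integrable_norm intg.
    exact: (integrableD measurableT intnf intng).
(* [f \min g] is below [g] everywhere, as [le_Rintegral] requires *)
rewrite (@ae_eq_Rintegral f (f \min g))//; last first.
  by apply: filterS fg => w fgw; rewrite /= min_l.
by apply: le_Rintegral => // w _ /=; rewrite ge_min lexx orbT.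
Qed.

(** This is how strict inequalities between integrals are obtained below: an
    equality of integrals would force an equality that fails on an event of
    positive probability. *)
Lemma ae_eq_of_Rintegral_le f g : P.-integrable setT (EFin \o f) ->
  P.-integrable setT (EFin \o g) -> {ae P, forall w, f w <= g w} ->
  \int[P]_w g w <= \int[P]_w f w -> {ae P, forall w, f w = g w}.
Proof.
move=> intf intg fg gf.
have intd : P.-integrable setT (EFin \o (fun w => g w - f w)).
  exact: (integrableB measurableT intg intf).
have d0 : \int[P]_w `|g w - f w| = 0.
  transitivity (\int[P]_w (g w - f w)).
    apply: ae_eq_Rintegral => //; first exact: integrable_norm intd.
    by apply: filterS fg => w fgw; rewrite ger0_norm ?subr_ge0.
  rewrite RintegralB//; apply/eqP; rewrite subr_eq0 eq_le gf.
  exact: ae_le_Rintegral.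
have /ae_eq_integral_abs :
    (\int[P]_w `|(EFin \o (fun w => g w - f w)%R) w| = 0)%E.
  rewrite -[LHS]fineK; last first.
    by apply: integrable_fin_num => //; exact: integrable_abse.
  by congr EFin.
move=> /(_ measurableT (measurable_int _ intd)).
by apply: filterS => w /(_ I) /= [] /eqP; rewrite subr_eq0 => /eqP.
Qed.

Lemma ae_exists (A : set T) (p : T -> Prop) : measurable A -> (0 < P A)%E ->
  {ae P, forall w, p w} -> exists2 w, A w & p w.
Proof.
move=> mA PA [N [mN PN sN]]; apply: contrapT => nex.
suff : (P A <= 0)%E by rewrite leNgt PA.
rewrite -PN; apply: le_measure; rewrite ?inE// => w Aw; apply: sN => /= pw.
by apply: nex; exists w.
Qed.

End ae_integral.

(** * The loss function and its clipped inverse derivative *)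

Section loss_calculus.
Context (R : realType) (K : R) (D : set R) (a : R) (b : \bar R) (ell : R -> R).
Hypothesis K_gt0 : 0 < K.
Hypothesis L : loss_function K D a b ell.
Local Notation l' := (derive1 ell).

Lemma loss_dom x : 0 <= x <= K -> D x.
Proof. by move=> xK; apply: (loss_sub L); rewrite /= in_itv. Qed.

Let loss_tangent_le x y : D x -> D y -> ell x + l' x * (y - x) <= ell y.
Proof.
move=> Dx Dy; have [<-|xy] := eqVneq x y; first by rewrite subrr mulr0 addr0.
(* along the segment from [x] to [y], convexity bounds the difference
   quotients at 0 by [ell y - ell x] *)
pose g t := ell (x + t * (y - x)).
have dg : is_derive (0 : R) 1 g (l' x * (y - x)).
  have /derivableP := loss_derivable L (mem_set Dx).
  rewrite -derive1E => dell.
  have daff : is_derive (0 : R) 1 (fun t : R => x + t * (y - x)) (y - x).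
    by apply: is_derive_eq; rewrite scaler0 !add0r mul1r /GRing.scale/= mulr1.
  by apply: is_derive1_comp daff; rewrite mul0r addr0.
have [/cvg_ex[l gl] gE] := dg.
rewrite -lerBrDl -gE.
have -> : 'D_1 g (0 : R) = l by apply/cvg_lim => //; exact: gl.
have gl' : (h^-1 *: ((g \o shift 0) (h *: (1:R)) - g 0))
    @[h --> (0:R)^'+] --> l.
  apply: cvg_trans gl => A; rewrite /at_right /dnbhs /within /=.
  rewrite /nbhs/= => gA; apply: filterS gA => z zA z0.
  by apply: zA; rewrite gt_eqF.
rewrite -(cvg_lim _ gl')//; apply: limr_le; first by apply/cvg_ex; exists l.
near=> h.
have h0 : 0 < h by [].
have h1 : h < 1 by near: h; apply: nbhs_right_lt.
rewrite /g /= /GRing.scale/= mulr1 mul0r !addr0.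
rewrite ler_pdivrMl// lerBlDr.
have yx : y != x by rewrite eq_sym.
have := @loss_convex _ _ _ _ _ _ L y x h Dy Dx yx; rewrite h0 h1 => /(_ isT).
have -> : h * y + (1 - h) * x = x + h * (y - x) by ring.
by lra.
Unshelve. all: by end_near. Qed.

(** A strictly convex function lies below its chord at the midpoint, while the
    midpoint lies above the tangent. *)
Lemma loss_tangent_lt x y : D x -> D y -> x != y ->
  ell x + l' x * (y - x) < ell y.
Proof.
move=> Dx Dy xy.
have h : (0 : R) < (1 / 2 : R) < 1 by lra.
pose m := 1 / 2 * x + (1 - 1 / 2) * y.
have Dm : D m.
  have [lxy|lyx] := leP x y.
    by apply: (loss_interval L Dx Dy); rewrite /m; lra.
  by apply: (loss_interval L Dy Dx); rewrite /m; lra.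
have := loss_convex L Dx Dy xy h; rewrite -/m => c1.
have := loss_tangent_le Dx Dm.
rewrite (_ : m - x = (y - x) / 2); last by rewrite /m; field.
by move=> c2; lra.
Qed.

Lemma loss_deriv_lt x y : D x -> D y -> x < y -> l' x < l' y.
Proof.
move=> Dx Dy xy.
have /= t1 := loss_tangent_lt Dx Dy (negbT (lt_eqF xy)).
have := loss_tangent_lt Dy Dx (negbT (gt_eqF xy)); nra.
Qed.

Lemma loss_deriv_le x y : D x -> D y -> x <= y -> l' x <= l' y.
Proof.
move=> Dx Dy; rewrite le_eqVlt => /predU1P[->//|xy].
exact/ltW/loss_deriv_lt.
Qed.

Lemma loss_deriv_range x : D x -> a < l' x /\ ((l' x)%:E < b)%E.
Proof. by case: (loss_bij L) => + _ _ => /[apply]. Qed.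

Lemma loss_deriv_gt0 x : D x -> 0 < l' x.
Proof.
by move=> /loss_deriv_range[al _]; exact: le_lt_trans (loss_range_ge0 L) al.
Qed.

Lemma loss_le x y : D x -> D y -> x <= y -> ell x <= ell y.
Proof.
move=> Dx Dy; rewrite le_eqVlt => /predU1P[->//|xy].
by apply/ltW/(loss_incr L); rewrite ?inE.
Qed.

Local Notation inv_l' := (ext_inv D a b ell).

Lemma ext_invK x : D x -> inv_l' (l' x) = x%:E.
Proof.
move=> Dx; have [ax xb] := loss_deriv_range Dx.
rewrite /ext_inv leNgt xb/= leNgt ax/=; congr EFin.
apply: pinvKV; last exact/mem_set.
by case: (loss_bij L).
Qed.

Lemma ext_invP s : [\/ s <= a /\ inv_l' s = -oo%E,
  (b <= s%:E)%E /\ inv_l' s = +oo%E |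
  exists x, [/\ D x, l' x = s & inv_l' s = x%:E]].
Proof.
have [bs|sb] := leP b s%:E; first by apply: Or32; rewrite /ext_inv bs.
have [sa|sa] := leP s a; first by apply: Or31; rewrite /ext_inv leNgt sb/= sa.
case: (loss_bij L) => _ _ /(_ s (conj sa sb))[x Dx xs].
by apply: Or33; exists x; split=> //; rewrite -xs ext_invK.
Qed.

(** Clipping the extended inverse to [0, K] gives a real-valued function that
    inverts the derivative of the loss on [0, K] and is 0 below and K above the
    values taken there, so that infinite values need no special case. *)
Definition clip_inv (s : R) : R := fine (mine (maxe 0%:E (inv_l' s)) K%:E).

Local Notation h := clip_inv.

Lemma clip_inv_real s x : inv_l' s = x%:E -> h s = Num.min (Num.max 0 x) K.
Proof. by move=> e; rewrite /clip_inv e -EFin_max -EFin_min. Qed.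

Lemma clip_inv_itv s : 0 <= h s <= K.
Proof.
case: (ext_invP s) => [[_ e]|[_ e]|[x [_ _ /clip_inv_real->]]].
- by rewrite /clip_inv e maxeNy -EFin_min /= min_l ?lexx ltW.
- by rewrite /clip_inv e maxey minye /= lexx ltW.
- by rewrite le_min le_max lexx ge_min lexx orbT (ltW K_gt0).
Qed.

Lemma clip_invK x : 0 <= x <= K -> h (l' x) = x.
Proof.
move=> /[dup] xK /loss_dom Dx; rewrite (clip_inv_real (ext_invK Dx)).
by rewrite max_r ?min_l//; lra.
Qed.

(** With [clip_inv_lt], this Galois-type characterisation carries the order
    and continuity properties of the clipped inverse. *)
Lemma clip_inv_gt x s : 0 <= x < K -> (x < h s) = (l' x < s).
Proof.
move=> xK; have Dx : D x by apply: loss_dom; lra.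
have [al lb] := loss_deriv_range Dx.
case: (ext_invP s) => [[sa e]|[bs e]|[z [Dz <- /clip_inv_real->]]].
- rewrite /clip_inv e maxeNy -EFin_min /= min_l ?(ltW K_gt0)//.
  by rewrite !ltNge (le_trans sa (ltW al)); case/andP: xK => ->.
- rewrite /clip_inv e maxey minye /=; case/andP: xK => _ ->.
  by rewrite -lte_fin (lt_le_trans lb bs).
- rewrite lt_min lt_max (ltNge x 0); case/andP: (xK) => -> -> /=.
  rewrite andbT; apply/idP/idP; first exact: loss_deriv_lt.
  by apply: contraTT; rewrite -!leNgt; exact: loss_deriv_le.
Qed.

Lemma clip_inv_lt x s : 0 < x <= K -> (h s < x) = (s < l' x).
Proof.
move=> xK; have Dx : D x by apply: loss_dom; lra.
have [al lb] := loss_deriv_range Dx.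
case: (ext_invP s) => [[sa e]|[bs e]|[z [Dz <- /clip_inv_real->]]].
- rewrite /clip_inv e maxeNy -EFin_min /= min_l ?(ltW K_gt0)//.
  by case/andP: xK => -> _; rewrite (le_lt_trans sa al).
- rewrite /clip_inv e maxey minye /=; case/andP: xK => _ xK.
  by rewrite ltNge xK/= -lte_fin ltNge (le_trans (ltW lb) bs).
- rewrite gt_min gt_max (ltNge K x); case/andP: (xK) => -> -> /=.
  rewrite orbF; apply/idP/idP; first exact: loss_deriv_lt.
  by apply: contraTT; rewrite -!leNgt; exact: loss_deriv_le.
Qed.

Lemma clip_inv_le s t : s <= t -> h s <= h t.
Proof.
move=> st; rewrite leNgt; apply/negP => hts.
have /andP[hs0 hsK] := clip_inv_itv s; have /andP[ht0 htK] := clip_inv_itv t.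
have htK' : 0 <= h t < K by rewrite ht0 (lt_le_trans hts hsK).
have := ltxx (h t); rewrite clip_inv_gt// (lt_le_trans _ st)//.
by rewrite -clip_inv_gt.
Qed.

Lemma clip_inv_eq0 s : s <= l' 0 -> h s = 0.
Proof.
move=> sl; apply/eqP; rewrite eq_le; have /andP[-> _] := clip_inv_itv s.
by rewrite andbT leNgt clip_inv_gt ?lexx// -leNgt.
Qed.

Lemma deriv_clip_inv s : l' 0 <= s -> h s < K -> l' (h s) = s.
Proof.
move=> ls hK; have /andP[h0 _] := clip_inv_itv s.
apply/eqP; rewrite eq_le; apply/andP; split.
  have [h_gt0|hn] := ltP 0 (h s).
    by rewrite leNgt -clip_inv_lt ?ltxx// h_gt0 ltW.
  by rewrite (_ : h s = 0)//; apply/eqP; rewrite eq_le h0 hn.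
by rewrite leNgt -clip_inv_gt ?ltxx// h0.
Qed.

Lemma clip_inv_continuous : continuous h.
Proof.
move=> s; apply/cvgrPdist_lt => e e0.
have /andP[hs0 hsK] := clip_inv_itv s.
have lower : \forall t \near s, h s - e < h t.
  have [hse|hse] := ltP (h s - e) 0.
    by near=> t; case/andP: (clip_inv_itv t) => ht0 _; exact: lt_le_trans ht0.
  have hK : 0 <= h s - e < K by lra.
  have : l' (h s - e) < s by rewrite -clip_inv_gt//; lra.
  by move/lt_nbhsr; apply: filterS => t; rewrite -clip_inv_gt.
have upper : \forall t \near s, h t < h s + e.
  have [hse|hse] := ltP K (h s + e).
    by near=> t; case/andP: (clip_inv_itv t) => _ htK; exact: le_lt_trans hse.
  have hK : 0 < h s + e <= K by lra.
  have : s < l' (h s + e) by rewrite -clip_inv_lt//; lra.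
  by move/lt_nbhsl; apply: filterS => t; rewrite -clip_inv_lt.
near=> t.
have lo : h s - e < h t by near: t.
have up : h t < h s + e by near: t.
by rewrite ltr_norml; lra.
Unshelve. all: by end_near. Qed.

Lemma measurable_clip_inv : measurable_fun setT h.
Proof. by apply: nondecreasing_measurable => //; exact: clip_inv_le. Qed.

(** Only the values of the loss on [0, K] matter, and there it coincides with
    the monotone function obtained by first clipping the argument. *)
Lemma measurable_loss (d : measure_display) (T : measurableType d)
    (X : T -> R) :
  measurable_fun setT X -> (forall w, 0 <= X w <= K) ->
  measurable_fun setT (ell \o X).
Proof.
move=> mX XK; pose clip (x : R) := Num.min (Num.max x 0) K.
have clipK x : 0 <= clip x <= K.
  rewrite /clip ge_min lexx orbT le_min le_max lexx orbT/=.
  by rewrite (ltW K_gt0).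
rewrite (_ : ell \o X = (ell \o clip) \o X).
  apply: measurableT_comp mX; apply: nondecreasing_measurable => //= x y xy.
  apply: loss_le; [exact: loss_dom|exact: loss_dom|].
  by rewrite /clip le_min2// le_max2.
apply/funext => w /=; have /andP[X0 XwK] := XK w.
by rewrite /clip max_l// min_l.
Qed.

(** The first-order condition of the pointwise problem: the derivative of
    [ell x - m * x] at [h m] vanishes or, when [h m] is an endpoint of [0, K],
    has the sign that excludes a descent into the interval. *)
Lemma clip_inv_Lagrangian m x : 0 <= x <= K -> x != h m ->
  ell (h m) - m * h m < ell x - m * x.
Proof.
move=> xK xh; have hK := clip_inv_itv m.
have Dx := loss_dom xK; have Dh := loss_dom hK.
have hx : h m != x by rewrite eq_sym.
have := loss_tangent_lt Dh Dx hx.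
have [lt_xh|lt_hx|exh] := ltgtP x (h m); last by rewrite exh eqxx in xh.
- have : l' (h m) <= m.
    rewrite leNgt -clip_inv_lt ?ltxx//.
    by case/andP: xK => x0 _; case/andP: hK => _ ->; rewrite (le_lt_trans x0).
  by nra.
- have : m <= l' (h m).
    rewrite leNgt -clip_inv_gt ?ltxx//.
    case/andP: xK => _ xK; case/andP: hK => -> _.
    by rewrite (lt_le_trans lt_hx).
  by nra.
Qed.

(** With [ext_inv_form_ge], this removes the extended inverse from the solution
    formula, whose argument always dominates the derivative at [beta]. *)
Lemma ext_inv_form beta s : D beta -> 0 <= beta < K -> l' beta <= s ->
  (beta%:E + mine (inv_l' s - inv_l' (l' beta)) (K - beta)%R%:E = (h s)%:E)%E.
Proof.
move=> Db bK bs; rewrite ext_invK//; have [al lb] := loss_deriv_range Db.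
case: (ext_invP s) => [[sa _]|[_ e]|[x [Dx xs e]]].
- by have := lt_le_trans al (le_trans bs sa); rewrite ltxx.
- by rewrite /clip_inv e addye// maxey !minye -EFinD/= subrKC.
- have bx : beta <= x.
    rewrite leNgt; apply/negP => xb.
    by have := loss_deriv_lt Dx Db xb; rewrite xs ltNge bs.
  rewrite (clip_inv_real e) e -EFinB -EFin_min -EFinD; congr EFin.
  rewrite max_r; last by lra.
  by rewrite /Num.min ltrD2r; case: ifP => _; lra.
Qed.

Lemma ext_inv_form_ge beta s : D beta -> K <= beta -> l' beta <= s ->
  (beta%:E + mine (inv_l' s - inv_l' (l' beta)) (K - beta)%R%:E = K%:E)%E.
Proof.
move=> Db bK bs; rewrite ext_invK//; have [al lb] := loss_deriv_range Db.
case: (ext_invP s) => [[sa _]|[_ e]|[x [Dx xs e]]].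
- by have := lt_le_trans al (le_trans bs sa); rewrite ltxx.
- by rewrite e addye// !minye -EFinD subrKC.
- have bx : beta <= x.
    rewrite leNgt; apply/negP => xb.
    by have := loss_deriv_lt Dx Db xb; rewrite xs ltNge bs.
  rewrite e -EFinB -EFin_min -EFinD; congr EFin.
  by rewrite min_r; lra.
Qed.

End loss_calculus.

(** * The price density and its truncation level *)

Section price_density.
Context (R : realType) (d : measure_display) (T : measurableType d).
Variables (P : probability T R) (phi : {RV P >-> R}).
Hypothesis phi_gt0 : {ae P, forall w, 0 < phi w}.
Hypothesis phi_mean : ('E_P[phi] = 1)%E.
Hypothesis cdf_increasing :
  {in `]0, +oo[ &, {homo cdf phi : x y / (x < y)%R >-> (x < y)%E}}.

Lemma integrable_price : P.-integrable setT (EFin \o phi).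
Proof.
apply/integrableP; split; first exact/measurable_EFinP.
rewrite (ae_eq_integral (EFin \o phi)) //=.
- by have := phi_mean; rewrite unlock => ->; rewrite ltry.
- by apply/measurable_EFinP; exact: measurableT_comp.
- exact/measurable_EFinP.
- by apply: filterS phi_gt0 => w p0 _; rewrite gtr0_norm.
Qed.

Lemma Rintegral_price : \int[P]_w phi w = 1.
Proof. by rewrite /Rintegral; have := phi_mean; rewrite unlock => ->. Qed.

Lemma cdfE x : cdf phi x = P [set w | phi w <= x].
Proof.
by rewrite /cdf /distribution /pushforward; congr (P _).
Qed.

Lemma measurable_price_band s t : measurable [set w | s < phi w < t].
Proof.
rewrite (_ : [set w | _] = phi @^-1` `]s, t[%classic).
  exact: measurable_funPTI.
by apply/seteqP; split=> w /=; rewrite in_itv.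
Qed.

Lemma measurable_price_le x : measurable [set w | phi w <= x].
Proof.
rewrite (_ : [set w | _] = phi @^-1` `]-oo, x]%classic).
  exact: measurable_funPTI.
by apply/seteqP; split=> w /=; rewrite in_itv.
Qed.

Lemma price_band_gt0 s t : 0 <= s < t -> (0 < P [set w | (s < phi w < t)%R])%E.
Proof.
(* the distribution function increases between two interior points, which
   are positive even when [s = 0] *)
move=> st; pose s' := (2 * s + t) / 3; pose t' := (s + 2 * t) / 3.
have s'0 : s' \in `]0, +oo[ by rewrite in_itv/= andbT /s'; lra.
have t'0 : t' \in `]0, +oo[ by rewrite in_itv/= andbT /t'; lra.
have st' : s' < t' by rewrite /s' /t'; lra.
have := cdf_increasing s'0 t'0 st'; rewrite !cdfE => lt_cdf.
rewrite lt0e measure_ge0 andbT; apply/eqP => P0.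
have : (P [set w | (phi w <= t')%R] <=
    P [set w | (phi w <= s')%R] + P [set w | (s < phi w < t)%R])%E.
  have ms' := measurable_price_le s'; have mst := measurable_price_band s t.
  apply: le_trans (measureU2 P ms' mst).
  apply: le_measure; rewrite ?inE.
  - exact: measurable_price_le.
  - apply: measurableU; first exact: measurable_price_le.
    exact: measurable_price_band.
  move=> w /= wt; case: (leP (phi w) s') => ws; [by left|right].
  by move: wt ws; rewrite /s' /t'; lra.
by rewrite P0 adde0 leNgt lt_cdf.
Qed.

Lemma cdf_at0 : cdf phi 0 = 0%E.
Proof.
rewrite cdfE; have [N [mN PN sN]] := phi_gt0.
apply/eqP; rewrite -measure_le0 -PN le_measure ?inE//.
  exact: measurable_price_le.
by move=> w /= w0; apply: sN => /=; rewrite ltNge w0.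
Qed.

Section quantile.
Variable t : R.
Hypothesis t01 : 0 < t < 1.
Local Notation q := (quantile phi t).

Let quantile_lbound x : (t%:E <= cdf phi x)%E -> 0 <= x.
Proof.
move=> tx; rewrite leNgt; apply/negP => x0.
have := le_trans tx (cdf_nondecreasing phi (ltW x0)).
by rewrite cdf_at0 lee_fin leNgt; case/andP: t01 => ->.
Qed.

Let cdf_lt_quantile x : x < q -> (cdf phi x < t%:E)%E.
Proof.
move=> xq; rewrite ltNge; apply/negP => tx.
have : q <= x by apply: ge_inf => //; exists 0 => y /=; exact: quantile_lbound.
by rewrite leNgt xq.
Qed.

Lemma quantile_gt0 : 0 < q.
Proof.
have [x x0 xt] : exists2 x, 0 < x & (cdf phi x < t%:E)%E.
  have : (\forall x \near (0 : R)^'+, (cdf phi x < t%:E)%E).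
    have : cdf phi x @[x --> (0 : R)^'+] --> 0%E.
      by rewrite -cdf_at0; exact: cdf_right_continuous.
    have t0 : (0 < t%:E)%E by rewrite lte_fin; case/andP: t01.
    by move=> /(_ _ (open_ereal_lt' t0)).
  move=> ct; near (0 : R)^'+ => x; exists x => //.
  by near: x.
apply: (lt_le_trans x0); apply: lb_le_inf.
  have : (\forall x \near +oo%R, (t%:E < cdf phi x)%E).
    have t1 : (t%:E < 1)%E by rewrite lte_fin; case/andP: t01.
    by have /(_ _ (open_ereal_gt' t1)) := @cvg_cdfy1 _ _ _ P phi.
  by move=> ct; near (pinfty_nbhs R) => y; exists y; apply/ltW; near: y.
move=> y /= ty; rewrite leNgt; apply/negP => yx.
have := le_lt_trans (le_trans ty (cdf_nondecreasing phi (ltW yx))) xt.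
by rewrite ltxx.
Unshelve. all: by end_near. Qed.

Lemma cdf_quantile : {in `]0, +oo[, continuous (cdf phi)} ->
  (cdf phi q <= t%:E)%E.
Proof.
move=> cdf_continuous.
have q0 : q \in `]0, +oo[ by rewrite in_itv/= quantile_gt0.
have cq : cdf phi x @[x --> q^'-] --> cdf phi q.
  exact/cvg_at_left_filter/cdf_continuous.
apply: cvge_le cq; near=> x; apply/ltW/cdf_lt_quantile.
by near: x; exact: nbhs_left_lt.
Unshelve. all: by end_near. Qed.

End quantile.

Lemma measurable_min_price y : measurable_fun setT (fun w => Num.min (phi w) y).
Proof. exact: measurable_minr. Qed.

Lemma integrable_min_price y :
  P.-integrable setT (EFin \o (fun w => Num.min (phi w) y)).
Proof.
apply: (@integrable_dominated _ _ _ _ _ (fun w => `|phi w| + `|y|)).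
- exact: measurable_min_price.
- have intc : P.-integrable setT (EFin \o cst `|y|).
    exact: finite_measure_integrable_cst.
  exact: (integrableD measurableT (integrable_norm integrable_price) intc).
- by move=> w; rewrite /Num.min; case: ifP => _; rewrite ?lerDl ?lerDr.
Qed.

(** The variable phi /\ q equals q on the event phi > q, whose probability
    is at least lambda, and it is moreover positive on 0 < phi < q. *)
Lemma quantile_lt_truncated_mean lambda : 0 < lambda < 1 ->
  {in `]0, +oo[, continuous (cdf phi)} ->
  lambda * quantile phi (1 - lambda) <
  \int[P]_w Num.min (phi w) (quantile phi (1 - lambda)).
Proof.
move=> l01 cdf_continuous; set q := quantile phi (1 - lambda).
have l01' : 0 < 1 - lambda < 1 by lra.
have q0 : 0 < q by exact: quantile_gt0.
pose A := [set w | q < phi w].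
have AC : A = ~` [set w | phi w <= q].
  by apply/seteqP; split=> w; rewrite /A /= ltNge => /negP.
have mA : measurable A by rewrite AC; apply/measurableC/measurable_price_le.
have lA : lambda <= fine (P A).
  have : (P [set w | (phi w <= q)%R] <= (1 - lambda)%:E)%E.
    by rewrite -cdfE; exact: cdf_quantile.
  rewrite AC probability_setC; last exact: measurable_price_le.
  have mq := measurable_price_le q.
  rewrite -(@fineK _ (P [set w | (phi w <= q)%R])) ?fin_num_measure//.
  by rewrite -EFinB/= lee_fin; lra.
have int1 : P.-integrable setT (EFin \o (fun w => q * \1_A w)).
  apply: (@integrable_bounded _ _ _ _ _ q).
    by apply: measurable_funM => //; exact: measurable_indic.
  move=> w; rewrite indicE.
  case: (w \in A); rewrite ?mulr1 ?mulr0 ?normr0 ?(ltW q0)//.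
  by rewrite gtr0_norm.
have le1 : {ae P, forall w, q * \1_A w <= Num.min (phi w) q}.
  apply: filterS phi_gt0 => w w0; rewrite indicE.
  have [/set_mem /= wA|_] := boolP (w \in A).
    by rewrite mulr1 min_r// ltW.
  by rewrite mulr0 le_min (ltW w0) ltW.
have q1 : \int[P]_w (q * \1_A w) = q * fine (P A).
  rewrite RintegralZl//; last exact: integrable_indic.
  by rewrite /Rintegral integral_indic// setIT.
apply: (@le_lt_trans _ _ (\int[P]_w (q * \1_A w))).
  by rewrite q1 mulrC ler_pM2l.
rewrite lt_neqAle (ae_le_Rintegral int1 (integrable_min_price q) le1) andbT.
apply/negP => /eqP e.
have ge1 : \int[P]_w Num.min (phi w) q <= \int[P]_w (q * \1_A w) by rewrite e.
have := ae_eq_of_Rintegral_le int1 (integrable_min_price q) le1 ge1.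
have q0q : 0 <= (0 : R) < q by rewrite lexx.
move=> /(ae_exists (measurable_price_band 0 q) (price_band_gt0 q0q)).
move=> [w /= /andP[w0 wq]].
rewrite indicE memNset /A/=; last by apply/negP; rewrite -leNgt ltW.
by rewrite mulr0 min_l ?ltW// => /esym/eqP; rewrite gt_eqF.
Qed.

(** The function G(y) = E[phi /\ y] - lambda y is continuous, positive at q,
    and nonpositive at 1 / lambda because E[phi] = 1. *)
Lemma exists_truncation_level lambda : 0 < lambda < 1 ->
  {in `]0, +oo[, continuous (cdf phi)} ->
  exists2 y, quantile phi (1 - lambda) < y &
    \int[P]_w Num.min (phi w) y = lambda * y.
Proof.
move=> l01 cdf_continuous; set q := quantile phi (1 - lambda).
have ql := quantile_lt_truncated_mean l01 cdf_continuous.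
have l01' : 0 < 1 - lambda < 1 by lra.
have q0 : 0 < q by exact: quantile_gt0.
have l0 : 0 < lambda by lra.
have le1 y : \int[P]_w Num.min (phi w) y <= 1.
  rewrite -Rintegral_price; apply: le_Rintegral => //.
  - exact: integrable_min_price.
  - exact: integrable_price.
  - by move=> w _; rewrite ge_min lexx.
pose G y := \int[P]_w Num.min (phi w) y - lambda * y.
have Gcont : {in `]0, lambda^-1 + 1[, continuous G}.
  move=> y yI; apply: (@cvgB _ R^o).
    apply: (@continuity_under_integral _ _ _ P (fun y w => Num.min (phi w) y)
      setT measurableT 0 (lambda^-1 + 1) _ _ (fun w => `|phi w|)) => //.
    - by move=> x _; exact: integrable_min_price.
    - apply: aeW => w _ x _; apply: continuous_min => //; exact: cst_continuous.
    - exact: integrable_norm integrable_price.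
    - move=> x; rewrite /= in_itv/= => /andP[x0 _].
      apply: filterS phi_gt0 => w w0 _.
      rewrite ger0_norm; last by rewrite le_min (ltW w0) ltW.
      by rewrite ge_min ler_norm.
    by move: yI; rewrite inE.
  by apply: (@cvgM R^o) => //; exact: cvg_cst.
have qlt : q <= lambda^-1.
  by rewrite -(ler_pM2l l0) mulfV ?gt_eqF// (le_trans (ltW ql)).
have [] := @IVT R G q lambda^-1 0 qlt.
- apply: continuous_in_subspaceT => y; rewrite inE/= in_itv/= => yI.
  by apply: Gcont; rewrite in_itv/=; lra.
- rewrite ge_min le_max; apply/andP; split; apply/orP; [right|left].
    by rewrite /G mulfV ?gt_eqF// subr_le0.
  by rewrite /G subr_ge0 ltW.
move=> y; rewrite in_itv/= => /andP[qy _] /eqP; rewrite subr_eq0 => /eqP Gy.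
exists y => //; rewrite lt_neqAle qy andbT; apply/eqP => e.
by move: ql; rewrite -/q e Gy ltxx.
Qed.

End price_density.

(** * Measures with bounded densities *)

Section bounded_density.
Context (R : realType) (d : measure_display) (T : measurableType d).
Variable P : probability T R.

Lemma probability_of_density (psi : T -> R) :
  P.-integrable setT (EFin \o psi) -> (forall w, 0 <= psi w) ->
  \int[P]_w psi w = 1 ->
  exists Q : probability T R, forall A, Q A = (\int[P]_(w in A) (psi w)%:E)%E.
Proof.
move=> intpsi psi0 psi1.
pose m (A : set T) := (\int[P]_(w in A) (psi w)%:E)%E.
have m0 : m set0 = 0%E by rewrite /m integral_set0.
have mge0 A : (0 <= m A)%E by apply: integral_ge0 => w _; rewrite lee_fin.
have msigma : semi_sigma_additive m.
  apply: semi_sigma_additive_nng_induced; first exact: measurable_int intpsi.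
  by move=> w; rewrite lee_fin.
pose m_isMeasure := isMeasure.Build _ _ _ m m0 mge0 msigma.
pose mu : {measure set T -> \bar R} := HB.pack m m_isMeasure.
have muT : mu setT = 1%E.
  rewrite /= /m -[LHS]fineK; first by congr EFin.
  exact: integrable_fin_num.
pose mu_isProbability := Measure_isProbability.Build _ _ _ mu muT.
pose Q : probability T R := HB.pack m m_isMeasure mu_isProbability.
by exists Q.
Qed.

Lemma Radon_Nikodym_density (Q : probability T R) (psi : T -> R) :
  P.-integrable setT (EFin \o psi) ->
  (forall A, Q A = (\int[P]_(w in A) (psi w)%:E)%E) ->
  Q `<< P /\
  ae_eq P setT (Radon_Nikodym (charge_of_finite_measure Q) P) (EFin \o psi).
Proof.
move=> intpsi QE.
have QP : Q `<< P.
  apply/null_content_dominatesP => A mA PA.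
  rewrite QE null_set_integral//.
  by apply: measurable_funTS; exact: measurable_int intpsi.
split=> //; apply: integral_ae_eq => //.
- exact: Radon_Nikodym_integrable.
- exact: measurable_int intpsi.
- move=> A _ mA; rewrite -Radon_Nikodym_integral//.
  exact: QE.
Qed.

Lemma expectation_density (Q : probability T R) (f psi : T -> R) (M : R) :
  Q `<< P -> P.-integrable setT (EFin \o psi) ->
  ae_eq P setT (Radon_Nikodym (charge_of_finite_measure Q) P) (EFin \o psi) ->
  measurable_fun setT f -> (forall w, `|f w| <= M) ->
  'E_Q[f]%E = (\int[P]_w (psi w * f w))%:E.
Proof.
move=> QP intpsi RN mf fM; rewrite unlock.
rewrite -(Radon_Nikodym_change_of_variables QP)//; last first.
  exact: (@integrable_bounded _ _ _ Q f M).
have intm := integrable_bounded_mul intpsi mf fM.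
rewrite [RHS]fineK; last exact: integrable_fin_num.
apply: ae_eq_integral => //.
- apply: emeasurable_funM; first exact/measurable_EFinP.
  by apply: measurable_int; exact: Radon_Nikodym_integrable.
- exact: measurable_int intm.
- by apply: filterS RN => w /[apply] ->; rewrite /= -EFinM mulrC.
Qed.

(** A real-valued representative of the density, for use with real integrals. *)
Lemma Q_density lambda (Q : probability T R) : Q_ P lambda Q ->
  exists r : T -> R, [/\ P.-integrable setT (EFin \o r), \int[P]_w r w = 1,
    {ae P, forall w, r w <= lambda^-1} &
    forall (f : T -> R) M, measurable_fun setT f -> (forall w, `|f w| <= M) ->
      'E_Q[f]%E = (\int[P]_w (r w * f w))%:E].
Proof.
move=> [QP RNle].
pose RN := Radon_Nikodym (charge_of_finite_measure Q) P.
have RNE w : RN w = (fine (RN w))%:E by rewrite fineK// Radon_Nikodym_fin_num.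
have intr : P.-integrable setT (EFin \o (fine \o RN)).
  rewrite (_ : EFin \o _ = RN); first exact: Radon_Nikodym_integrable.
  by apply/funext => w /=; rewrite -RNE.
have ED (f : T -> R) M : measurable_fun setT f -> (forall w, `|f w| <= M) ->
    'E_Q[f]%E = (\int[P]_w (fine (RN w) * f w))%:E.
  by apply: expectation_density => //; apply: aeW => w _ /=; rewrite -RNE.
exists (fine \o RN); split => //.
- have n1 (w : T) : `|cst 1 w : R| <= 1 by rewrite normr1.
  have := ED (cst 1) 1 (measurable_cst _) n1; rewrite expectation_cst => -[->].
  by apply: eq_Rintegral => w _; rewrite mulr1.
- by apply: filterS RNle => w; rewrite -/(RN w) RNE lee_fin.
Qed.

(** Moving mass to where [f] exceeds its lower bound [beta] increases the
    expectation, and [psi] already puts there as much as the constraint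
    allows. *)
Lemma expectation_le_worst_case lambda (Q : probability T R)
    (f psi : T -> R) (M beta : R) : Q_ P lambda Q ->
  measurable_fun setT f -> (forall w, `|f w| <= M) ->
  P.-integrable setT (EFin \o psi) -> \int[P]_w psi w = 1 ->
  {ae P, forall w, beta <= f w} ->
  {ae P, forall w, beta < f w -> psi w = lambda^-1} ->
  ('E_Q[f] <= (\int[P]_w (psi w * f w))%:E)%E.
Proof.
move=> /Q_density[r [intr r1 rle ED]] mf fM intpsi psi1 fge psiE.
rewrite (ED f M)// lee_fin.
have intrf := integrable_bounded_mul intr mf fM.
have intpf := integrable_bounded_mul intpsi mf fM.
(* both densities have mass one, so subtracting [beta] from [f] shifts the
   two expectations equally *)
have shift (g : T -> R) : P.-integrable setT (EFin \o g) -> \int[P]_w g w = 1 ->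
    P.-integrable setT (EFin \o (fun w => g w * (f w - beta))) /\
    \int[P]_w (g w * (f w - beta)) = \int[P]_w (g w * f w) - beta.
  move=> intg g1; have intgf := integrable_bounded_mul intg mf fM.
  have intgb := @integrable_bounded_mul _ _ _ _ _ (cst beta) `|beta|
    intg (measurable_cst _) (fun=> lexx _).
  have E : (fun w => g w * (f w - beta)) = (fun w => g w * f w - g w * beta).
    by apply/funext => w; rewrite mulrBr.
  split.
    rewrite E; exact: (integrableB measurableT intgf intgb).
  rewrite E RintegralB//; congr (_ - _).
  by rewrite RintegralZr// g1 mul1r.
have [intrfb rfb] := shift r intr r1.
have [intpfb pfb] := shift psi intpsi psi1.
rewrite -(lerD2r (- beta)) -rfb -pfb; apply: ae_le_Rintegral => //.
apply: filterS3 rle fge psiE => w rw fw pw.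
have [fb|bf] := leP (f w) beta.
  rewrite (_ : f w - beta = 0) ?mulr0//.
  by apply/eqP; rewrite subr_eq0 eq_le fb.
by rewrite pw// ler_wpM2r// subr_ge0.
Qed.

End bounded_density.

(** * Positions of the announced form *)

Section form_parameters.
Context (R : realType) (d : measure_display) (T : measurableType d).
Variables (P : probability T R) (K : R) (phi : {RV P >-> R}).
Variables (D : set R) (a : R) (b : \bar R) (ell : R -> R).
Hypothesis K_gt0 : 0 < K.
Hypothesis phi_gt0 : {ae P, forall w, 0 < phi w}.
Hypothesis L : loss_function K D a b ell.
Hypothesis cdf_increasing :
  {in `]0, +oo[ &, {homo cdf phi : x y / (x < y)%R >-> (x < y)%E}}.
Variable lambda : R.
Hypothesis l01 : 0 < lambda < 1.

Local Notation h := (clip_inv K D a b ell).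
Local Notation l' := (derive1 ell).
Local Notation form := (NP_form phi K ell D a b lambda).

Let q_gt0 : 0 < quantile phi (1 - lambda).
Proof.
apply: quantile_gt0 => //.
by case/andP: l01 => l0 l1; rewrite subr_gt0 l1 ltrBlDr ltrDl.
Qed.

Lemma form_scale X beta y c : form X beta y c ->
  [/\ 0 < y, 0 < c & c * y = l' beta].
Proof.
move=> [[Db b0] qy -> _]; have y0 := lt_le_trans q_gt0 qy.
by rewrite divr_gt0 ?(loss_deriv_gt0 L)// divfK// gt_eqF.
Qed.

(** Since [c * y] is the derivative of the loss at [beta], the formula is the
    clipped inverse at [c * Num.max (phi w) y] as soon as [beta < K]. *)
Lemma form_position X beta y c : form X beta y c -> beta < K ->
  {ae P, forall w, X w = h (c * Num.max (phi w) y)}.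
Proof.
move=> F bK; have [y0 c0 cy] := form_scale F; case: F => [[Db b0] _ _].
apply: filterS => w /=; rewrite cy (ext_inv_form L)// ?b0//.
  by move=> [].
by rewrite -cy ler_pM2l// le_max lexx orbT.
Qed.

Lemma form_cap X beta y c : form X beta y c -> K <= beta ->
  {ae P, forall w, X w = K}.
Proof.
move=> F bK; have [y0 c0 cy] := form_scale F; case: F => [[Db b0] _ _].
apply: filterS => w /=; rewrite cy (ext_inv_form_ge L)//.
  by move=> [].
by rewrite -cy ler_pM2l// le_max lexx orbT.
Qed.

(** The base value [beta] is read off where phi is below both levels; the
    position leaves it exactly when phi passes the level [y]. *)
Lemma form_parameters_unique X1 X2 beta1 y1 c1 beta2 y2 c2 :
  form X1 beta1 y1 c1 -> form X2 beta2 y2 c2 -> beta1 < K -> beta2 < K ->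
  {ae P, forall w, X1 w = X2 w} ->
  [/\ beta1 = beta2, y1 = y2 & c1 = c2].
Proof.
move=> F1 F2 b1K b2K X12.
have [y1_gt0 c1_gt0 cy1] := form_scale F1.
have [y2_gt0 c2_gt0 cy2] := form_scale F2.
have [[D1 b1] _ c1E _] := F1; have [[D2 b2] _ c2E _] := F2.
have hE : {ae P, forall w,
    h (c1 * Num.max (phi w) y1) = h (c2 * Num.max (phi w) y2)}.
  apply: filterS3 X12 (form_position F1 b1K) (form_position F2 b2K) => w.
  by move=> X12w <- <-.
have hy1 : h (c1 * y1) = beta1 by rewrite cy1 (clip_invK L)// b1 ltW.
have hy2 : h (c2 * y2) = beta2 by rewrite cy2 (clip_invK L)// b2 ltW.
have band s t : 0 <= s < t -> exists2 w, s < phi w < t &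
    h (c1 * Num.max (phi w) y1) = h (c2 * Num.max (phi w) y2).
  move=> st; have band_gt0 := price_band_gt0 cdf_increasing st.
  exact: ae_exists (measurable_price_band phi s t) band_gt0 hE.
have b12 : beta1 = beta2.
  have [|w /andP[_ wy]] := band 0 (Num.min y1 y2).
    by rewrite lexx lt_min y1_gt0.
  move: wy; rewrite lt_min => /andP[wy1 wy2].
  by rewrite max_r ?(ltW wy1)// max_r ?(ltW wy2)// hy1 hy2.
have y12 : y1 = y2.
  have [lt12|lt21|//] := ltgtP y1 y2.
    have [|w /andP[w1 w2]] := band y1 y2; first by rewrite (ltW y1_gt0).
    rewrite max_l ?(ltW w1)// max_r ?(ltW w2)// hy2 => e.
    have : beta1 < h (c1 * phi w).
      by rewrite (clip_inv_gt K_gt0 L) ?b1// -cy1 ltr_pM2l.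
    by rewrite e b12 ltxx.
  have [|w /andP[w2 w1]] := band y2 y1; first by rewrite (ltW y2_gt0).
  rewrite max_r ?(ltW w1)// max_l ?(ltW w2)// hy1 => e.
  have : beta2 < h (c2 * phi w).
    by rewrite (clip_inv_gt K_gt0 L) ?b2// -cy2 ltr_pM2l.
  by rewrite -e b12 ltxx.
by rewrite c1E c2E b12 y12.
Qed.

End form_parameters.

(** * The worst-case measure and the optimal positions *)

Section worst_case.
Context (R : realType) (d : measure_display) (T : measurableType d).
Variables (P : probability T R) (K : R) (phi : {RV P >-> R}).
Variables (D : set R) (a : R) (b : \bar R) (ell : R -> R).
Hypothesis K_gt0 : 0 < K.
Hypothesis phi_gt0 : {ae P, forall w, 0 < phi w}.
Hypothesis phi_mean : ('E_P[phi] = 1)%E.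
Hypothesis L : loss_function K D a b ell.
Hypothesis cdf_increasing :
  {in `]0, +oo[ &, {homo cdf phi : x y / (x < y)%R >-> (x < y)%E}}.
Variables (lambda y0 : R).
Hypothesis l01 : 0 < lambda < 1.
Hypothesis y0_gt : quantile phi (1 - lambda) < y0.
Hypothesis y0_mean : \int[P]_w Num.min (phi w) y0 = lambda * y0.

Local Notation h := (clip_inv K D a b ell).
Local Notation l' := (derive1 ell).

Let y0_gt0 : 0 < y0.
Proof.
apply: lt_trans y0_gt; apply: quantile_gt0 => //.
by case/andP: l01 => l0 l1; rewrite subr_gt0 l1 ltrBlDr ltrDl.
Qed.

Let l_gt0 : 0 < lambda. Proof. by case/andP: l01. Qed.

Let ly0 : 0 < lambda * y0. Proof. exact: mulr_gt0. Qed.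

(** The maximum with 0 only matters on the null event where phi is not
    positive; it makes the density nonnegative everywhere. *)
Definition worst_density (w : T) : R :=
  Num.max 0 (Num.min (phi w) y0) / (lambda * y0).

Local Notation psi := worst_density.

Lemma worst_density_ge0 w : 0 <= psi w.
Proof. by rewrite divr_ge0 ?(ltW ly0)// le_max lexx. Qed.

Lemma integrable_worst_density : P.-integrable setT (EFin \o psi).
Proof.
apply: (@integrable_bounded _ _ _ _ _ (y0 / (lambda * y0))).
- apply: measurable_funM => //; apply: measurable_maxr => //.
  exact: measurable_minr.
- move=> w; rewrite ger0_norm ?worst_density_ge0//.
  by rewrite ler_pM2r ?invr_gt0// ge_max (ltW y0_gt0) ge_min lexx orbT.
Qed.

Lemma worst_density_mass : \int[P]_w psi w = 1.
Proof.
have intm := integrable_min_price phi_gt0 phi_mean y0.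
transitivity (\int[P]_w (Num.min (phi w) y0 / (lambda * y0))).
  apply: ae_eq_Rintegral.
  - exact: integrable_worst_density.
  - have /= := integrableZl measurableT (lambda * y0)^-1 intm.
    by apply: eq_integrable => // w _ /=; rewrite EFinM muleC.
  - apply: filterS phi_gt0 => w w0; rewrite /worst_density max_r//.
    by rewrite le_min (ltW w0) ltW.
by rewrite RintegralZr// y0_mean divff// gt_eqF.
Qed.

Lemma worst_density_above w : y0 <= phi w -> psi w = lambda^-1.
Proof.
move=> yw; rewrite /worst_density min_r// max_r ?(ltW y0_gt0)//.
by rewrite invfM mulrCA divff ?mulr1// gt_eqF.
Qed.

Lemma worst_density_le w : psi w <= lambda^-1.
Proof.
rewrite ler_pdivrMr// mulrA mulVf ?gt_eqF// mul1r.
by rewrite ge_max (ltW y0_gt0) ge_min lexx orbT.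
Qed.

Lemma worst_density_gt0 w : 0 < phi w -> 0 < psi w.
Proof. by move=> w0; rewrite divr_gt0// lt_max lt_min w0 y0_gt0 orbT. Qed.

(** This identity makes the Lagrange condition of the problem under the
    worst-case measure depend on phi \/ y0 alone. *)
Lemma worst_density_ratio w : 0 < phi w ->
  psi w * Num.max (phi w) y0 = phi w / lambda.
Proof.
move=> w0; rewrite /worst_density max_r; last by rewrite le_min (ltW w0) ltW.
have y00 : y0 != 0 by rewrite gt_eqF.
have l0 : lambda != 0 by rewrite gt_eqF.
by have [_|_] := leP (phi w) y0; field; rewrite y00 l0.
Qed.

Lemma worst_case_probability : exists Q : probability T R,
  Q_ P lambda Q /\
  forall (f : T -> R) M, measurable_fun setT f -> (forall w, `|f w| <= M) ->
    'E_Q[f]%E = (\int[P]_w (psi w * f w))%:E.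
Proof.
have [Q QE] := probability_of_density integrable_worst_density
  worst_density_ge0 worst_density_mass.
have [QP RN] := Radon_Nikodym_density integrable_worst_density QE.
exists Q; split.
- split=> //; apply: filterS RN => w /(_ I) ->.
  by rewrite lee_fin worst_density_le.
- move=> f M mf fM.
  exact: expectation_density QP integrable_worst_density RN mf fM.
Qed.

Lemma loss_bounded (X : T -> R) : (forall w, 0 <= X w <= K) ->
  forall w, `|(ell \o X) w| <= Num.max `|ell 0| `|ell K|.
Proof.
move=> XK w; have Kge0 := ltW K_gt0.
have /andP[X0 Xw] := XK w.
have D0 : D 0 by apply: (loss_dom L); rewrite lexx.
have DK : D K by apply: (loss_dom L); rewrite lexx Kge0.
have DX : D (X w) by exact: (loss_dom L).
have l0X := loss_le L D0 DX X0; have lXK := loss_le L DX DK Xw.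
rewrite le_max /=; have [e|e] := leP 0 (ell (X w)).
  by rewrite ger0_norm// (le_trans lXK (ler_norm _)) orbT.
rewrite ltr0_norm// (@le_trans _ _ (- ell 0)) ?lerN2//.
by rewrite -normrN ler_norm.
Qed.

Lemma worst_loss_le_rho (X : {RV P >-> R}) : (forall w, 0 <= X w <= K) ->
  ((\int[P]_w (psi w * ell (X w)))%:E <= rho lambda ell X)%E.
Proof.
move=> XK; have [Q [QQ QE]] := worst_case_probability.
have mX : measurable_fun setT (ell \o X) by exact: (measurable_loss K_gt0 L).
rewrite -(QE _ _ mX (loss_bounded XK)).
by apply: ereal_sup_ubound; exists Q.
Qed.

Definition opt_position c (w : T) : R := h (c * Num.max (phi w) y0).

Lemma opt_position_itv c w : 0 <= opt_position c w <= K.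
Proof. exact: clip_inv_itv. Qed.

Lemma measurable_opt_position c : measurable_fun setT (opt_position c).
Proof.
apply: measurableT_comp; first exact: (measurable_clip_inv K_gt0 L).
by apply: measurable_funM => //; exact: measurable_maxr.
Qed.

(** The position exceeds its minimum [h (c * y0)] only where phi > y0, and
    there the worst-case density has its largest admissible value. *)
Lemma rho_opt_position (X : {RV P >-> R}) c :
  0 < c -> X = opt_position c :> (T -> R) ->
  rho lambda ell X = (\int[P]_w (psi w * ell (X w)))%:E.
Proof.
move=> c0 XE; have XK w : 0 <= X w <= K by rewrite XE opt_position_itv.
apply/eqP; rewrite eq_le worst_loss_le_rho// andbT.
apply: ge_ereal_sup => _ [Q QQ <-].
have mX : measurable_fun setT (ell \o X) by exact: (measurable_loss K_gt0 L).
apply: (@expectation_le_worst_case _ _ _ _ lambda Q (ell \o X) psi _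
  (ell (h (c * y0))) QQ mX (loss_bounded XK)).
- exact: integrable_worst_density.
- exact: worst_density_mass.
- apply: aeW => w; apply: (loss_le L).
  + exact/(loss_dom L)/(clip_inv_itv K_gt0 L).
  + exact/(loss_dom L).
  + rewrite XE; apply: (clip_inv_le K_gt0 L).
    by rewrite ler_pM2l// le_max lexx orbT.
- apply: aeW => w /= lt_ell; apply: worst_density_above.
  rewrite leNgt; apply/negP => wy.
  by move: lt_ell; rewrite XE /opt_position max_r ?(ltW wy)// ltxx.
Qed.

Definition cost c : R := \int[P]_w (phi w * opt_position c w).

Lemma integrable_price_mul (Y : T -> R) : measurable_fun setT Y ->
  (forall w, 0 <= Y w <= K) ->
  P.-integrable setT (EFin \o (fun w => phi w * Y w)).
Proof.
move=> mY YK; apply: (@integrable_bounded_mul _ _ _ _ _ _ K) => //.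
  exact: integrable_price.
by move=> w; case/andP: (YK w) => Y0 YwK; rewrite ger0_norm.
Qed.

(** The Lagrange argument: integrate the pointwise inequality with multiplier
    c / lambda and use that [Y] costs at least as much as [opt_position c].
    Equality of the integrals forces equality in the strict pointwise
    inequality. *)
Lemma opt_position_optimal c (Y : T -> R) : 0 <= c -> measurable_fun setT Y ->
  (forall w, 0 <= Y w <= K) -> cost c <= \int[P]_w (phi w * Y w) ->
  \int[P]_w (psi w * ell (opt_position c w)) <= \int[P]_w (psi w * ell (Y w)) /\
  (\int[P]_w (psi w * ell (Y w)) <= \int[P]_w (psi w * ell (opt_position c w)) ->
   {ae P, forall w, Y w = opt_position c w}).
Proof.
move=> c0 mY YK costY; set X := opt_position c.
have mX : measurable_fun setT X by exact: measurable_opt_position.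
have XK : forall w, 0 <= X w <= K by exact: opt_position_itv.
have intl (Z : T -> R) : measurable_fun setT Z -> (forall w, 0 <= Z w <= K) ->
    P.-integrable setT (EFin \o (fun w => psi w * ell (Z w))).
  move=> mZ ZK; apply: (integrable_bounded_mul integrable_worst_density).
    exact: (measurable_loss K_gt0 L mZ ZK).
  exact: (loss_bounded ZK).
have intX := integrable_price_mul mX XK.
have intY := integrable_price_mul mY YK.
(* the pointwise lower bound of the loss of [Y] given by the multiplier *)
pose u w := psi w * ell (X w) + c / lambda * (phi w * Y w - phi w * X w).
have intd : P.-integrable setT (EFin \o (fun w => phi w * Y w - phi w * X w)).
  exact: (integrableB measurableT intY intX).
have intcd : P.-integrable setT
    (EFin \o (fun w => c / lambda * (phi w * Y w - phi w * X w))).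
  have /= := integrableZl measurableT (c / lambda) intd.
  by apply: eq_integrable => // w _ /=; rewrite EFinM.
have intu : P.-integrable setT (EFin \o u).
  exact: (integrableD measurableT (intl _ mX XK) intcd).
have uE : \int[P]_w u w = \int[P]_w (psi w * ell (X w)) +
    c / lambda * (\int[P]_w (phi w * Y w) - cost c).
  by rewrite /u RintegralD//; [rewrite RintegralZl// RintegralB|exact: intl].
have uge : \int[P]_w (psi w * ell (X w)) <= \int[P]_w u w.
  by rewrite uE lerDl mulr_ge0 ?subr_ge0// divr_ge0// ltW.
have u_lt w : 0 < phi w -> Y w != X w -> u w < psi w * ell (Y w).
  move=> w0 YX.
  have : ell (X w) - c * Num.max (phi w) y0 * X w <
      ell (Y w) - c * Num.max (phi w) y0 * Y w.
    exact: clip_inv_Lagrangian.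
  rewrite -(ltr_pM2l (worst_density_gt0 w0)) !mulrBr.
  have E z : psi w * (c * Num.max (phi w) y0 * z) = c / lambda * (phi w * z).
    by rewrite mulrA mulrCA worst_density_ratio//; ring.
  by rewrite !E /u; lra.
have u_le : {ae P, forall w, u w <= psi w * ell (Y w)}.
  apply: filterS phi_gt0 => w w0; have [YX|YX] := eqVneq (Y w) (X w).
    by rewrite /u YX subrr mulr0 addr0.
  exact/ltW/u_lt.
have le_u := ae_le_Rintegral intu (intl _ mY YK) u_le.
split; first exact: le_trans le_u.
move=> le_YX; have := ae_eq_of_Rintegral_le intu (intl _ mY YK) u_le
  (le_trans le_YX uge).
apply: filterS2 phi_gt0 => w w0 uY; apply/eqP; apply: contraT => YX.
by have := u_lt w w0 YX; rewrite uY ltxx.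
Qed.

Lemma admissibleP v (Y : {RV P >-> R}) : admissible phi K v Y <->
  (forall w, 0 <= Y w <= K) /\ v <= \int[P]_w (phi w * Y w).
Proof.
rewrite /admissible unlock.
have E : (forall w, 0 <= Y w <= K) ->
    (\int[P]_w (phi w * Y w)%:E)%E = (\int[P]_w (phi w * Y w))%:E.
  move=> YK; rewrite [RHS]fineK//; apply: integrable_fin_num => //.
  exact: integrable_price_mul.
by split=> -[YK]; have := E YK => /= ->; rewrite lee_fin.
Qed.

Lemma NP_solution_opt_position (X : {RV P >-> R}) c : 0 < c ->
  X = opt_position c :> (T -> R) -> NP_solution phi K ell lambda (cost c) X.
Proof.
move=> c0 XE; have XK w : 0 <= X w <= K by rewrite XE opt_position_itv.
split; first by apply/admissibleP; split => //; rewrite XE.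
move=> Y /admissibleP[YK costY].
rewrite (rho_opt_position c0 XE); apply: le_trans (worst_loss_le_rho YK).
rewrite lee_fin XE; have [//|+ _] := opt_position_optimal (ltW c0) _ YK costY.
by [].
Qed.

Lemma NP_solution_unique (Y : {RV P >-> R}) c : 0 < c ->
  NP_solution phi K ell lambda (cost c) Y ->
  {ae P, forall w, Y w = opt_position c w}.
Proof.
move=> c0 [/admissibleP[YK costY] Ymin].
have mX := measurable_opt_position c.
pose X : {RV P >-> R} :=
  HB.pack (opt_position c) (isMeasurableFun.Build _ _ _ _ _ mX).
have XE : X = opt_position c :> (T -> R) by [].
have [_] := opt_position_optimal (ltW c0) (measurable_funPT Y) YK costY; apply.
rewrite -lee_fin; apply: le_trans (worst_loss_le_rho YK) _.
apply: le_trans (Ymin X _) _.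
  by have [] := NP_solution_opt_position c0 XE.
by rewrite (rho_opt_position c0 XE).
Qed.

(** A pointwise strict inequality on one band of values of phi is enough, as
    every band has positive probability. *)
Lemma Rintegral_price_mul_lt (X Y : T -> R) s t :
  measurable_fun setT X -> (forall w, 0 <= X w <= K) ->
  measurable_fun setT Y -> (forall w, 0 <= Y w <= K) ->
  (forall w, 0 < phi w -> X w <= Y w) -> 0 <= s < t ->
  (forall w, s < phi w < t -> X w < Y w) ->
  \int[P]_w (phi w * X w) < \int[P]_w (phi w * Y w).
Proof.
move=> mX XK mY YK XY st XYst.
have iX := integrable_price_mul mX XK; have iY := integrable_price_mul mY YK.
have le_XY : {ae P, forall w, phi w * X w <= phi w * Y w}.
  by apply: filterS phi_gt0 => w w0; rewrite ler_pM2l// XY.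
rewrite ltNge; apply/negP => /(ae_eq_of_Rintegral_le iX iY le_XY).
move/(ae_exists (measurable_price_band phi s t)
  (price_band_gt0 cdf_increasing st)) => [w /= wst]; have w0 : 0 < phi w by lra.
by move=> /(mulfI (negbT (gt_eqF w0))) e; have := XYst w wst; rewrite e ltxx.
Qed.

Lemma integrable_cost c :
  P.-integrable setT (EFin \o (fun w => phi w * opt_position c w)).
Proof.
exact: integrable_price_mul (measurable_opt_position c) (opt_position_itv c).
Qed.

Lemma cost_le c1 c2 : c1 <= c2 -> cost c1 <= cost c2.
Proof.
move=> c12; apply: ae_le_Rintegral.
- exact: integrable_cost.
- exact: integrable_cost.
apply: filterS phi_gt0 => w w0; rewrite ler_pM2l//.
by apply: (clip_inv_le K_gt0 L); rewrite ler_wpM2r// le_max (ltW w0).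
Qed.

Lemma Rintegral_price_mul_cst x : \int[P]_w (phi w * x) = x.
Proof.
by rewrite RintegralZr ?(integrable_price phi_gt0)// Rintegral_price// mul1r.
Qed.

Let domK : D K. Proof. by apply: (loss_dom L); rewrite lexx ltW. Qed.
Let l0_gt0 : 0 < l' 0.
Proof. by apply/(loss_deriv_gt0 L)/(loss_dom L); rewrite lexx ltW. Qed.

(** At c = 0 the position vanishes, and at c = l'(K) / y0 it is identically K;
    dominated convergence makes the cost continuous in between. *)
Lemma exists_cost v : 0 < v < K -> exists2 c, 0 < c & cost c = v.
Proof.
move=> v0K; pose B := l' K / y0.
have B0 : 0 < B by rewrite divr_gt0// (loss_deriv_gt0 L).
have cost0 : cost 0 = 0.
  rewrite -[RHS](Rintegral_price_mul_cst 0); apply: eq_Rintegral => w _.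
  by rewrite /opt_position mul0r (clip_inv_eq0 K_gt0 L)// ltW.
have costB : cost B = K.
  rewrite -[RHS](Rintegral_price_mul_cst K); apply: eq_Rintegral => w _.
  congr (_ * _); apply/eqP; rewrite eq_le.
  have /andP[_ ->] := opt_position_itv B w.
  rewrite leNgt (clip_inv_lt K_gt0 L) ?lexx ?K_gt0// -leNgt.
  by rewrite -[leLHS](divfK (negbT (gt_eqF y0_gt0))) ler_pM2l// le_max lexx orbT.
have cost_continuous : {in `]-1, B + 1[, continuous cost}.
  move=> c cI; apply: (@continuity_under_integral _ _ _ P
      (fun c w => phi w * opt_position c w) setT measurableT (-1) (B + 1) _ _
      (fun w => K * `|phi w|)) => //.
  - by move=> x _; exact: integrable_cost.
  - apply: aeW => w _ x _; apply: (@cvgM R^o); first exact: cvg_cst.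
    apply: (@continuous_comp _ _ _ (fun x : R => x * Num.max (phi w) y0) h).
      by apply: (@cvgM R^o) => //; exact: cvg_cst.
    exact: (clip_inv_continuous K_gt0 L).
  - have intphi := integrable_norm (integrable_price phi_gt0 phi_mean).
    have /= := integrableZl measurableT K intphi.
    by apply: eq_integrable => // w _ /=; rewrite EFinM.
  - move=> x _; apply: aeW => w _; rewrite normrM mulrC ler_wpM2r//.
    by have /andP[x0 xK] := opt_position_itv x w; rewrite ger0_norm.
  - by move: cI; rewrite inE.
have [] := @IVT R cost 0 B v (ltW B0).
- apply: continuous_in_subspaceT => c; rewrite inE/= in_itv/= => cI.
  by apply: cost_continuous; rewrite in_itv/=; lra.
- by rewrite cost0 costB min_l ?max_r ?(ltW K_gt0)//; lra.
move=> c; rewrite in_itv/= => /andP[c0 _] cv; exists c => //.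
rewrite lt_neqAle c0 andbT; apply/eqP => e.
by move: v0K; rewrite -cv -e cost0 ltxx.
Qed.

Lemma opt_position_lt_cap c : cost c < K -> h (c * y0) < K.
Proof.
rewrite 2!ltNge; apply: contraNN => Kh.
have [cneg|c0] := leP c 0.
  have : K <= 0; last by move=> /le_lt_trans/(_ K_gt0); rewrite ltxx.
  apply: le_trans Kh _.
  rewrite (clip_inv_eq0 K_gt0 L)// (le_trans _ (ltW l0_gt0))//.
  by rewrite mulr_le0_ge0// ltW.
rewrite -[leLHS]Rintegral_price_mul_cst; apply: ae_le_Rintegral.
- by apply: (@integrable_price_mul (cst K)) => // w; rewrite lexx ltW.
- exact: integrable_cost.
apply: filterS phi_gt0 => w w0; rewrite ler_pM2l// (le_trans Kh)//.
by apply: (clip_inv_le K_gt0 L); rewrite ler_pM2l// le_max lexx orbT.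
Qed.

(** The level [y] is the value of phi at which the position leaves its base:
    if [c * y0 < l' 0], the position vanishes beyond [y0], up to [l' 0 / c]. *)
Lemma opt_position_form (X : {RV P >-> R}) c : 0 < c -> cost c < K ->
  {ae P, forall w, X w = opt_position c w} ->
  NP_form phi K ell D a b lambda X (h (c * y0)) (Num.max y0 (l' 0 / c)) c.
Proof.
move=> c0 cK XE; set beta := h (c * y0); set y := Num.max y0 (l' 0 / c).
have bK : beta < K by exact: opt_position_lt_cap.
have /andP[b0 _] : 0 <= beta <= K by exact: clip_inv_itv.
have Db : D beta by apply: (loss_dom L); rewrite b0 ltW.
have y_gt0 : 0 < y by rewrite lt_max y0_gt0.
have cy : c * y = l' beta.
  rewrite /beta /y; have [ly|yl] := leP (l' 0 / c) y0.
    by rewrite (deriv_clip_inv K_gt0 L)// mulrC -ler_pdivrMr.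
  rewrite mulrC divfK ?gt_eqF// (clip_inv_eq0 K_gt0 L)//.
  by rewrite mulrC -ler_pdivlMr// ltW.
split.
- by [].
- by rewrite le_max (ltW y0_gt).
- by rewrite -cy mulfK// gt_eqF.
apply: filterS XE => w ->.
rewrite cy (ext_inv_form L)// ?b0//; last first.
  by rewrite -cy ler_pM2l// le_max lexx orbT.
(* below the level [l' 0 / c] both arguments are clipped to 0 *)
congr EFin; rewrite /opt_position /y.
have [//|yl] := leP (l' 0 / c) y0.
have [wl|lw] := leP (phi w) (l' 0 / c).
  rewrite !(clip_inv_eq0 K_gt0 L)//.
    by rewrite mulrC -ler_pdivlMr// ge_max wl lexx.
  by rewrite mulrC -ler_pdivlMr// ge_max wl ltW.
by rewrite !max_l// ltW// (lt_trans yl).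
Qed.

Definition critical_cost : R := cost (l' 0 / y0).

Let critical_y0 : l' 0 / y0 * y0 = l' 0.
Proof. by rewrite divfK// gt_eqF. Qed.

Let opt_critical_eq0 w : phi w <= y0 -> opt_position (l' 0 / y0) w = 0.
Proof.
move=> wy; rewrite /opt_position max_r// critical_y0.
exact: (clip_inv_eq0 K_gt0 L).
Qed.

Let opt_gt_base c w : l' 0 <= c * y0 -> h (c * y0) < K -> y0 < phi w ->
  h (c * y0) < opt_position c w.
Proof.
move=> lc hK yw.
have c0 : 0 < c by have := lt_le_trans l0_gt0 lc; rewrite pmulr_lgt0.
have /andP[hc0 _] := clip_inv_itv K_gt0 L (c * y0).
rewrite (clip_inv_gt K_gt0 L) ?hc0// (deriv_clip_inv K_gt0 L)//.
by rewrite max_l ?(ltW yw)// ltr_pM2l.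
Qed.

Lemma critical_cost_gt0 : 0 < critical_cost.
Proof.
rewrite -[ltLHS](Rintegral_price_mul_cst 0).
apply: (@Rintegral_price_mul_lt (cst 0) _ y0 (y0 + 1)) => //.
- by move=> w; rewrite lexx ltW.
- exact: measurable_opt_position.
- exact: opt_position_itv.
- by move=> w _; have /andP[] := opt_position_itv (l' 0 / y0) w.
- by rewrite (ltW y0_gt0) ltrDl ltr01.
move=> w /andP[yw _] /=.
have e : h (l' 0 / y0 * y0) = 0.
  by rewrite critical_y0 (clip_inv_eq0 K_gt0 L).
by rewrite -[ltLHS]e; apply: opt_gt_base => //; rewrite ?e// critical_y0.
Qed.

(** At the critical scale the position vanishes up to y0, in particular between
    q and y0, while it never exceeds K beyond. *)
Lemma critical_cost_lt : (critical_cost%:E < K%:E * expectation_on P phi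
  [set w | (quantile phi (1 - lambda) <= phi w)%R])%E.
Proof.
set q := quantile phi (1 - lambda); set A := [set w | q <= phi w].
have q_gt0 : 0 < q.
  apply: quantile_gt0 => //.
  by case/andP: l01 => l0 l1; rewrite subr_gt0 l1 ltrBlDr ltrDl.
have mA : measurable A.
  rewrite (_ : A = phi @^-1` `[q, +oo[%classic); first exact: measurable_funPTI.
  by apply/seteqP; split=> w; rewrite /A /= in_itv/= andbT.
pose Y w : R := K * \1_A w.
have mY : measurable_fun setT Y.
  by apply: measurable_funM => //; exact: measurable_indic.
have YK w : 0 <= Y w <= K.
  by rewrite /Y indicE; case: (w \in A); rewrite ?mulr1 ?mulr0 lexx ltW.
have -> : (K%:E * expectation_on P phi A = (\int[P]_w (phi w * Y w))%:E)%E.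
  rewrite /expectation_on unlock.
  have i1 : P.-integrable setT (EFin \o (fun w => phi w * \1_A w)).
    apply: (@integrable_bounded_mul _ _ _ _ _ _ 1).
    - exact: integrable_price.
    - exact: measurable_indic.
    - by move=> w; rewrite indicE; case: (w \in A); rewrite ?normr1 ?normr0.
  rewrite -integralZl// [RHS]fineK.
    by apply: eq_integral => w _; rewrite -EFinM mulrCA.
  exact/integrable_fin_num/integrable_price_mul.
rewrite lte_fin; apply: (@Rintegral_price_mul_lt _ _ q y0) => //.
- exact: measurable_opt_position.
- exact: opt_position_itv.
- move=> w w0; rewrite /Y indicE; case: (boolP (w \in A)) => wA.
    by rewrite mulr1; have /andP[] := opt_position_itv (l' 0 / y0) w.
  rewrite mulr0 opt_critical_eq0//.
  have /negP : ~ A w by move=> /mem_set; apply/negP.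
  by rewrite -ltNge => wq; apply/ltW/(lt_trans wq).
- by rewrite (ltW q_gt0).
move=> w /andP[qw wy].
rewrite opt_critical_eq0 ?(ltW wy)// /Y indicE mem_set ?mulr1//.
exact: ltW.
Qed.

(** A position with positive base exceeds the critical one on 0 < phi < y0, so
    it costs more; its own base is below the cost because the position exceeds
    it for phi > y0, and E[phi] = 1. *)
Lemma base_critical c : 0 < c -> cost c < K ->
  (cost c <= critical_cost -> h (c * y0) = 0) /\
  (critical_cost < cost c -> 0 < h (c * y0) < cost c).
Proof.
move=> c0 cK; have hK := opt_position_lt_cap cK.
have /andP[h0 _] := clip_inv_itv K_gt0 L (c * y0).
split.
  rewrite leNgt => le_cost; apply/eqP; rewrite eq_le h0 andbT leNgt.
  apply: contra le_cost => h_gt0.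
  have lc : l' 0 < c * y0 by rewrite -(clip_inv_gt K_gt0 L) ?lexx.
  have crit_c : l' 0 / y0 <= c by rewrite ler_pdivrMr// ltW.
  apply: (@Rintegral_price_mul_lt _ _ 0 y0).
  - exact: measurable_opt_position.
  - exact: opt_position_itv.
  - exact: measurable_opt_position.
  - exact: opt_position_itv.
  - move=> w w0; apply: (clip_inv_le K_gt0 L).
    by rewrite ler_wpM2r// le_max (ltW w0).
  - by rewrite lexx.
  - move=> w /andP[_ wy]; rewrite opt_critical_eq0 ?(ltW wy)//.
    by rewrite /opt_position max_r// ltW.
move=> lt_cost.
have lc : l' 0 / y0 < c.
  by rewrite ltNge; apply/negP => /cost_le; rewrite leNgt lt_cost.
have lc' : l' 0 < c * y0 by rewrite -ltr_pdivrMr.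
have h_gt0 : 0 < h (c * y0) by rewrite (clip_inv_gt K_gt0 L) ?lexx.
rewrite h_gt0 -[ltLHS]Rintegral_price_mul_cst.
apply: (@Rintegral_price_mul_lt (cst (h (c * y0))) _ y0 (y0 + 1)) => //.
- by move=> w; rewrite h0 ltW.
- exact: measurable_opt_position.
- exact: opt_position_itv.
- move=> w w0; apply: (clip_inv_le K_gt0 L).
  by rewrite ler_pM2l// le_max lexx orbT.
- by rewrite (ltW y0_gt0) ltrDl ltr01.
by move=> w /andP[yw _] /=; apply: opt_gt_base => //; exact: ltW.
Qed.

(** Stating the scale [c] before the solution makes it a function of [v]
    alone, which is what monotonicity in [v] is about. *)
Lemma NP_solution_parameters v : 0 < v < K ->
  exists c, [/\ 0 < c, cost c = v &
    forall (X : {RV P >-> R}) beta y c', NP_solution phi K ell lambda v X ->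
      NP_form phi K ell D a b lambda X beta y c' ->
      [/\ beta = h (c * y0), y = Num.max y0 (l' 0 / c) & c' = c]].
Proof.
move=> v0K; have [c c0 costc] := exists_cost v0K.
exists c; split => // X beta y c' solX F.
have cK : cost c < K by rewrite costc; lra.
rewrite -costc in solX.
have XE := NP_solution_unique c0 solX.
have F' := opt_position_form c0 cK XE.
have bK : beta < K.
  rewrite ltNge; apply/negP => /(form_cap phi_gt0 L l01 F) XK.
  have : cost c = K; last by move=> e; rewrite e ltxx in cK.
  rewrite -[RHS]Rintegral_price_mul_cst; apply: ae_eq_Rintegral.
  - exact: integrable_cost.
  - by apply: (@integrable_price_mul (cst K)) => // w; rewrite lexx ltW.
  by apply: filterS2 XE XK => w <- ->.
apply: (form_parameters_unique K_gt0 phi_gt0 L cdf_increasing l01 F F' bK).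
  exact: opt_position_lt_cap.
exact: aeW.
Qed.

End worst_case.

(** * The Neyman-Pearson problem *)

Theorem theorem3p1
    (R : realType) (d : measure_display) (T : measurableType d)
    (P : probability T R) (K : R) (phi : {RV P >-> R})
    (D : set R) (a : R) (b : \bar R) (ell : R -> R)
    (P_atomless : atomless P)
    (K_gt0 : 0 < K)
    (phi_unbounded : forall M : R, (0 < P [set w | (M < phi w)%R])%E)
    (phi_gt0 : {ae P, forall w, 0 < phi w})
    (phi_mean : ('E_P[phi] = 1)%E)
    (ell_loss : loss_function K D a b ell)
    (cdf_continuous : {in `]0, +oo[, continuous (cdf phi)})
    (cdf_increasing : {in `]0, +oo[ &, {homo cdf phi : x y / (x < y)%R >-> (x < y)%E}}) :
  [/\ (* (a) *)
      forall lambda v : R, 0 < lambda < 1 -> 0 < v < K ->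
      exists X : {RV P >-> R},
        [/\ NP_solution phi K ell lambda v X,
            forall Y : {RV P >-> R}, NP_solution phi K ell lambda v Y ->
              {ae P, forall w, Y w = X w} &
            exists beta y c : R, NP_form phi K ell D a b lambda X beta y c],
      (* (b) *)
      forall lambda : R, 0 < lambda < 1 ->
      exists vl : R,
        [/\ 0 < vl,
            (vl%:E < K%:E *
              expectation_on P phi
                [set w | (quantile phi (1 - lambda) <= phi w)%R])%E &
            forall (v : R) (X : {RV P >-> R}) (beta y c : R),
              0 < v < K ->
              NP_solution phi K ell lambda v X ->
              NP_form phi K ell D a b lambda X beta y c ->
              (v <= vl -> beta = 0) /\ (vl < v -> 0 < beta < v)] &
      (* (c): y is nonincreasing in v.  While beta = 0 one has c * y = ell'(0),
         so c and y cannot both be nondecreasing. *)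
      forall (lambda v1 v2 : R) (X1 X2 : {RV P >-> R})
             (beta1 y1 c1 beta2 y2 c2 : R),
        0 < lambda < 1 -> 0 < v1 -> v1 <= v2 -> v2 < K ->
        NP_solution phi K ell lambda v1 X1 ->
        NP_form phi K ell D a b lambda X1 beta1 y1 c1 ->
        NP_solution phi K ell lambda v2 X2 ->
        NP_form phi K ell D a b lambda X2 beta2 y2 c2 ->
        [/\ beta1 <= beta2, c1 <= c2 & y2 <= y1]
  ].
Proof.
have truncation lambda (l01 : 0 < lambda < 1) :=
  exists_truncation_level phi_gt0 phi_mean cdf_increasing l01 cdf_continuous.
split.
- move=> lambda v l01 v0K; have [y0 qy0 y0_mean] := truncation lambda l01.
  have [c c0 costc] := exists_cost K_gt0 phi_gt0 phi_mean ell_loss l01 qy0 v0K.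
  have mX := measurable_opt_position phi K_gt0 ell_loss y0 c.
  pose X : {RV P >-> R} :=
    HB.pack (opt_position K phi D a b ell y0 c)
      (isMeasurableFun.Build _ _ _ _ _ mX).
  have XE : X = opt_position K phi D a b ell y0 c :> (T -> R) by [].
  exists X; rewrite -costc; split.
  + exact: (NP_solution_opt_position K_gt0 phi_gt0 phi_mean ell_loss
      l01 qy0 y0_mean c0 XE).
  + move=> Y solY.
    exact: (NP_solution_unique K_gt0 phi_gt0 phi_mean ell_loss
      l01 qy0 y0_mean c0 solY).
  + have cK : cost K phi D a b ell y0 c < K by rewrite costc; lra.
    have XE' : {ae P, forall w, X w = opt_position K phi D a b ell y0 c w}.
      by apply: aeW.
    exists (clip_inv K D a b ell (c * y0)), (Num.max y0 (derive1 ell 0 / c)), c.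
    exact: (opt_position_form K_gt0 phi_gt0 phi_mean ell_loss
      l01 qy0 c0 cK XE').
- move=> lambda l01; have [y0 qy0 y0_mean] := truncation lambda l01.
  exists (critical_cost K phi D a b ell y0); split.
  + exact: (critical_cost_gt0 K_gt0 phi_gt0 phi_mean ell_loss cdf_increasing
      l01 qy0).
  + exact: (critical_cost_lt K_gt0 phi_gt0 phi_mean ell_loss cdf_increasing
      l01 qy0).
  move=> v X beta y c v0K solX F.
  have [c' [c'0 costc' /(_ X beta y c solX F)[-> _ _]]] :=
    NP_solution_parameters K_gt0 phi_gt0 phi_mean ell_loss cdf_increasing
      l01 qy0 y0_mean v0K.
  have c'K : cost K phi D a b ell y0 c' < K by rewrite costc'; lra.
  rewrite -costc'.
  exact: (base_critical K_gt0 phi_gt0 phi_mean ell_loss cdf_increasing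
    l01 qy0 c'0 c'K).
- move=> lambda v1 v2 X1 X2 beta1 y1 c1 beta2 y2 c2.
  move=> l01 v1_gt0 v12 v2K sol1 F1 sol2 F2.
  have [y0 qy0 y0_mean] := truncation lambda l01.
  have v10K : 0 < v1 < K by lra.
  have v20K : 0 < v2 < K by lra.
  have params := NP_solution_parameters K_gt0 phi_gt0 phi_mean ell_loss
    cdf_increasing l01 qy0 y0_mean.
  have [c [c0 costc H1]] := params v1 v10K.
  have [-> -> ->] := H1 _ _ _ _ sol1 F1.
  have [e|ne12] := eqVneq v1 v2.
    by move: sol2; rewrite -e => /H1/(_ F2)[-> -> ->].
  have [c' [c'0 costc' /(_ _ _ _ _ sol2 F2)[-> -> ->]]] := params v2 v20K.
  have cc' : c <= c'.
    rewrite leNgt; apply/negP => /ltW.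
    move=> /(cost_le K_gt0 phi_gt0 phi_mean ell_loss y0).
    by rewrite costc costc' leNgt lt_neqAle ne12 v12.
  split => //.
    apply: (clip_inv_le K_gt0 ell_loss); rewrite ler_pM2r//.
    apply: lt_trans qy0; apply: quantile_gt0 => //.
    by lra.
  rewrite ge_max !le_max lexx/= ler_pM2l; last first.
    by apply/(loss_deriv_gt0 ell_loss)/(loss_dom ell_loss); rewrite lexx ltW.
  by rewrite lef_pV2// cc' orbT.
Qed.
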